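(* Let $(\Omega,\Sigma,\mu)$ be a measure space with $\mu$ a nonnegative, finite, complete measure not vanishing identically, and let $p>0$. Then the metric $d_p$ defines a topology on $L^+_p$ which is equivalent to (i.e. the same as) the topology on $L^+_p$ defined by the metric $\rho_p$.
   Context: Let $\log^+a=\max\{\log a,0\}$ (with $\log^+0=0$). For $p>0$, $L^+_p=L^+_p(\mu)$ is the set of all (equivalence classes modulo $\mu$-a.e. equality of) $\Sigma$-measurable complex functions $f$ on $\Omega$ with $\int_\Omega(\log^+|f|)^p\,d\mu<\infty$; equivalently, with $(\|f\|_p)^p:=\int_\Omega(\log(1+|f|))^p\,d\mu<\infty$. It is an algebra under pointwise operations. The metric $d_p$ on $L^+_p$ is $$d_p(f,g)=\inf_{t>0}\big[t+\mu(\{x\in\Omega:|f(x)-g(x)|\ge t\})\big]+\int_\Omega\big|(\log^+|f(x)|)^p-(\log^+|g(x)|)^p\big|\,d\mu.$$ The metric $\rho_p$ on $L^+_p$ is $\rho_p(f,g)=\|f-g\|_p$ if $p>1$, and $\rho_p(f,g)=(\|f-g\|_p)^p$ if $0<p\le1$. Two metrics on the same space are called equivalent if they induce the same topology. *)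

(* Defs.v *)
From HB Require Import structures.
From mathcomp Require Import all_boot all_order all_algebra.
From mathcomp Require Import all_classical all_reals all_analysis.
From mathcomp Require Import measurable_realfun complex.
Set Implicit Arguments.
Unset Strict Implicit.
Unset Printing Implicit Defensive.
Import Order.TTheory GRing.Theory Num.Theory.
Import numFieldNormedType.Exports.
Import Normc.
Local Open Scope classical_set_scope.
Local Open Scope ring_scope.

(* [R[i]^o] carries the topology of the complex modulus; complex functions are
   measurable with respect to its Borel sigma-algebra. *)
HB.instance Definition _ (R : realType) :=
  Measurable.copy R[i] (g_sigma_algebraType (@open R[i]^o)).

Section definitions.
Context d (T : measurableType d) (R : realType).
Implicit Types (mu : {measure set T -> \bar R}) (p : R) (f g : T -> R[i]).

(* [ln 0 = 0], hence [logp 0 = 0]. [normc] is the modulus as an element of [R],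
   whereas [`|z|] is an element of [R[i]]. *)
Definition logp (a : R) : R := Num.max (ln a) 0.

Definition logp_summable mu p f : Prop :=
  (\int[mu]_x (logp (normc (f x)) `^ p)%:E < +oo)%E.

Definition lognorm mu p f : R :=
  (\int[mu]_x (ln (1 + normc (f x)) `^ p))%R `^ p^-1.

Definition dmeas mu f g : R :=
  inf [set t + fine (mu [set x | t <= normc (f x - g x)]) | t in [set t | 0 < t]].

Definition dp mu p f g : R :=
  dmeas mu f g
  + (\int[mu]_x `|logp (normc (f x)) `^ p - logp (normc (g x)) `^ p|)%R.

Definition rhop mu p f g : R :=
  if 1 < p then lognorm mu p (f \- g) else lognorm mu p (f \- g) `^ p.

(* [{mfun_ mu, T >-> R[i]}] is the quotient of the measurable functions by
   mu-a.e. equality; its elements coerce to a chosen representative. The choice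
   is immaterial, see [logp_summable_ae], [dp_ae] and [rhop_ae] below. *)
Definition Lplus mu p : Type :=
  {f : {mfun_ mu, T >-> R[i]} | `[< logp_summable mu p f >]}.

HB.instance Definition _ mu p := Choice.on (Lplus mu p).

Definition Lplus_fun mu p (f : Lplus mu p) : T -> R[i] := val f.

End definitions.
Coercion Lplus_fun : Lplus >-> Funclass.

Section real_lemmas.
Context {R : realType}.
Implicit Types a b p : R.

Lemma powR_add_le a b p : 0 <= a -> 0 <= b -> 0 < p ->
  (a + b) `^ p <= 2 `^ p * (a `^ p + b `^ p).
Proof.
move=> a0 b0 p0.
wlog ab : a b a0 b0 / a <= b.
  move=> H; have [|/ltW] := leP a b; first exact: H.
  by move=> ba; rewrite addrC [X in _ * X]addrC; exact: H.
apply: (@le_trans _ _ ((2 * b) `^ p)).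
  apply: ge0_ler_powR; rewrite ?nnegrE; [exact: ltW|exact: addr_ge0| |].
  - by rewrite mulr_ge0.
  - by rewrite mulr_natl mulr2n lerD2r.
by rewrite powRM// ler_wpM2l ?powR_ge0// lerDr powR_ge0.
Qed.

Lemma powR_subadd a b p : 0 <= a -> 0 <= b -> 0 < p <= 1 ->
  (a + b) `^ p <= a `^ p + b `^ p.
Proof.
move=> a0 b0 /andP[p0 p1].
have [s0|s0] := eqVneq (a + b) 0.
  by rewrite s0 powR0 ?gt_eqF// addr_ge0 ?powR_ge0.
have s_gt0 : 0 < a + b by rewrite lt_neqAle eq_sym s0 addr_ge0.
have key c : 0 <= c -> c <= a + b -> (a + b) `^ p * (c / (a + b)) <= c `^ p.
  move=> c0 cs.
  have [->|cN0] := eqVneq c 0; first by rewrite mul0r mulr0 powR_ge0.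
  have c_gt0 : 0 < c by rewrite lt_neqAle eq_sym cN0.
  have q0 : 0 < c / (a + b) by rewrite divr_gt0.
  rewrite -[in X in _ <= X](divfK s0 c) mulrC powRM ?(ltW q0) ?(ltW s_gt0)//.
  rewrite ler_wpM2r ?powR_ge0//.
  by rewrite ger1_powR// q0 ler_pdivrMr// mul1r.
apply: le_trans (lerD (key a a0 _) (key b b0 _)); rewrite ?lerDl ?lerDr//.
by rewrite -mulrDr -mulrDl divff// mulr1.
Qed.

Lemma normc_ge0 (z : R[i]) : 0 <= normc z.
Proof. by case: z => x y; rewrite sqrtr_ge0. Qed.

Lemma normcBC (z w : R[i]) : normc (z - w) = normc (w - z).
Proof. by rewrite -(@normcN R) opprB. Qed.

Lemma normcB_triangle (z w v : R[i]) :
  normc (z - v) <= normc (z - w) + normc (w - v).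
Proof. by rewrite -[z](subrK w) -addrA (le_trans (le_normcD _ _))// addrK. Qed.

Lemma ln1_ge0 a : 0 <= a -> 0 <= ln (1 + a).
Proof. by move=> a0; rewrite ln_ge0// lerDl. Qed.

Lemma ln1_mono a b : 0 <= a -> a <= b -> ln (1 + a) <= ln (1 + b).
Proof.
move=> a0 ab; rewrite ler_ln ?posrE ?lerD2l// ltr_wpDr//.
exact: le_trans ab.
Qed.

Lemma ln1_add a b : 0 <= a -> 0 <= b ->
  ln (1 + (a + b)) <= ln (1 + a) + ln (1 + b).
Proof.
move=> a0 b0; rewrite -lnM ?posrE ?ltr_wpDr//.
rewrite ler_ln ?posrE ?ltr_wpDr ?mulr_gt0 ?ltr_wpDr ?addr_ge0//.
by rewrite mulrDl mul1r mulrDr mulr1 !addrA [1 + b + a]addrAC lerDl mulr_ge0.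
Qed.

Lemma logp_ge0 a : 0 <= logp a.
Proof. by rewrite /logp le_max lexx orbT. Qed.

Lemma logp_le a : 0 <= a -> logp a <= ln (1 + a).
Proof.
move=> a0; rewrite /logp ge_max ln1_ge0// andbT.
have [->|aN0] := eqVneq a 0; first by rewrite ln0// ln1_ge0.
have a_gt0 : 0 < a by rewrite lt_neqAle eq_sym aN0.
by rewrite ler_ln ?posrE ?lerDr// ltr_wpDr.
Qed.

Lemma ln1_le_logp a : 0 <= a -> ln (1 + a) <= ln 2 + logp a.
Proof.
move=> a0; rewrite /logp.
have [a1|a1] := leP a 1.
  rewrite (@le_trans _ _ (ln 2))//; last by rewrite lerDl le_max lexx orbT.
  by rewrite ler_ln ?posrE ?ltr_wpDr// -[2]/(1 + 1) lerD2l.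
have a_gt0 : 0 < a by rewrite (lt_trans _ a1).
rewrite (@le_trans _ _ (ln 2 + ln a))//; last by rewrite lerD2l le_max lexx.
rewrite -lnM ?posrE// ler_ln ?posrE ?mulr_gt0 ?ltr_wpDr//.
by rewrite mulr_natl mulr2n lerD2r ltW.
Qed.

End real_lemmas.

Section measurability.
Context d (T : measurableType d) (R : realType).
Implicit Types (f g : T -> R[i]) (p : R).

Lemma normr_normc (z : R[i]) : (`|z| : R[i]) = (normc z +i* 0)%C.
Proof. by case: z. Qed.

Lemma Re_le_normc (z : R[i]) : `|complex.Re z| <= normc z.
Proof. by case: z => a b /=; rewrite -sqrtr_sqr ler_wsqrtr// lerDl sqr_ge0. Qed.

Lemma Im_le_normc (z : R[i]) : `|complex.Im z| <= normc z.
Proof. by case: z => a b /=; rewrite -sqrtr_sqr ler_wsqrtr// lerDr sqr_ge0. Qed.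

Lemma lipschitz_open_preimage (h : R[i] -> R) (U : set R) :
  (forall z w, `|h z - h w| <= normc (z - w)) -> open U ->
  open (h @^-1` U : set R[i]^o).
Proof.
move=> hl; rewrite !openE => Uo z /Uo /nbhs_ballP[e /= e0 eU].
apply/nbhs_ballP; exists (e +i* 0)%C => /=; first by rewrite ltcR.
move=> w; rewrite /ball/= => zw; apply: eU.
rewrite /ball/= (le_lt_trans (hl z w))//.
by move: zw; rewrite normr_normc => /andP[].
Qed.

Lemma measurable_lipschitz (h : R[i] -> R) f :
  (forall z w, `|h z - h w| <= normc (z - w)) ->
  measurable_fun setT f -> measurable_fun setT (h \o f).
Proof.
move=> hl mf; apply: measurableT_comp mf.
apply: (measurability _ (RGenOpens.measurableE R)) => _ [_ [a [b ->] <-]].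
rewrite setTI; apply: sub_sigma_algebra.
exact/lipschitz_open_preimage/interval_open.
Qed.

Lemma measurable_Re f : measurable_fun setT f ->
  measurable_fun setT (fun x => complex.Re (f x)).
Proof.
apply: measurable_lipschitz => -[a b] [a' b'].
exact: (Re_le_normc ((a +i* b)%C - (a' +i* b')%C)).
Qed.

Lemma measurable_Im f : measurable_fun setT f ->
  measurable_fun setT (fun x => complex.Im (f x)).
Proof.
apply: measurable_lipschitz => -[a b] [a' b'].
exact: (Im_le_normc ((a +i* b)%C - (a' +i* b')%C)).
Qed.

Lemma measurable_normc_Re_Im f : measurable_fun setT (fun x => complex.Re (f x)) ->
  measurable_fun setT (fun x => complex.Im (f x)) ->
  measurable_fun setT (fun x => normc (f x)).
Proof.
move=> mr mi.
rewrite (_ : (fun x => _) =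
  Num.sqrt \o (fun x => complex.Re (f x) ^+ 2 + complex.Im (f x) ^+ 2)); last first.
  by apply/funext => x /=; case: (f x).
apply: measurableT_comp.
  by apply: continuous_measurable_fun; exact: sqrt_continuous.
by apply: measurable_funD; exact: measurable_funX.
Qed.

Lemma measurable_normc f : measurable_fun setT f ->
  measurable_fun setT (fun x => normc (f x)).
Proof.
by move=> mf; apply: measurable_normc_Re_Im;
  [exact: measurable_Re|exact: measurable_Im].
Qed.

Lemma measurable_normcB f g : measurable_fun setT f -> measurable_fun setT g ->
  measurable_fun setT (fun x => normc (f x - g x)).
Proof.
move=> mf mg; apply: measurable_normc_Re_Im.
- rewrite (_ : (fun x => _) = (fun x => complex.Re (f x)) \- (fun x => complex.Re (g x))).
    by apply: measurable_funB; exact: measurable_Re.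
  by apply/funext => x /=; case: (f x) (g x) => [? ?] [? ?].
- rewrite (_ : (fun x => _) = (fun x => complex.Im (f x)) \- (fun x => complex.Im (g x))).
    by apply: measurable_funB; exact: measurable_Im.
  by apply/funext => x /=; case: (f x) (g x) => [? ?] [? ?].
Qed.

Lemma measurable_logp (u : T -> R) p : measurable_fun setT u ->
  measurable_fun setT (fun x => logp (u x) `^ p).
Proof.
move=> mu_; apply: (measurableT_comp (measurable_powR p)).
by apply: measurable_maxr => //; exact: measurableT_comp.
Qed.

Lemma measurable_ln1 (u : T -> R) : measurable_fun setT u ->
  measurable_fun setT (fun x => ln (1 + u x)).
Proof.
by move=> mu_; apply: measurableT_comp => //; exact: measurable_funD.
Qed.

Lemma measurable_ln1p (u : T -> R) p : measurable_fun setT u ->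
  measurable_fun setT (fun x => ln (1 + u x) `^ p).
Proof.
by move=> ?; apply: (measurableT_comp (measurable_powR p)); exact: measurable_ln1.
Qed.

End measurability.

Section integrability.
Context d (T : measurableType d) (R : realType).
Context (mu : {finite_measure set T -> \bar R}) (p : R) (p0 : 0 < p).
Implicit Types f g : T -> R[i].

Lemma integrable_ge0 (u : T -> R) : measurable_fun setT u ->
  (forall x, 0 <= u x) -> (\int[mu]_x (u x)%:E < +oo)%E ->
  mu.-integrable setT (EFin \o u).
Proof.
move=> mu_ u0 ioo; apply/integrableP; split; first exact/measurable_EFinP.
rewrite (eq_integral (fun x => (u x)%:E))// => x _ /=.
by rewrite ger0_norm.
Qed.

Lemma integrable_logp f : measurable_fun setT f -> logp_summable mu p f ->
  mu.-integrable setT (fun x => (logp (normc (f x)) `^ p)%:E).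
Proof.
move=> mf sf; apply: integrable_ge0 => //.
  exact/measurable_logp/measurable_normc.
by move=> x; exact: powR_ge0.
Qed.

Lemma integrable_logpB f g : measurable_fun setT f -> measurable_fun setT g ->
  logp_summable mu p f -> logp_summable mu p g ->
  mu.-integrable setT
    (fun x => (`|logp (normc (f x)) `^ p - logp (normc (g x)) `^ p|)%:E).
Proof.
move=> mf mg sf sg.
apply: (@integrable_abse _ _ _ _ _
  (fun x => (logp (normc (f x)) `^ p - logp (normc (g x)) `^ p)%:E)).
exact: (integrableB measurableT (integrable_logp mf sf) (integrable_logp mg sg)).
Qed.

Lemma integrable_ln1 f : measurable_fun setT f -> logp_summable mu p f ->
  mu.-integrable setT (fun x => (ln (1 + normc (f x)) `^ p)%:E).
Proof.
move=> mf sf.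
have : mu.-integrable setT (fun x =>
    ((2 `^ p)%:E * ((ln 2 `^ p)%:E + (logp (normc (f x)) `^ p)%:E))%E).
  apply: integrableZl => //; apply: integrableD => //.
    exact: finite_measure_integrable_cst.
  exact: integrable_logp.
apply: le_integrable => //.
  exact/measurable_EFinP/measurable_ln1p/measurable_normc.
move=> x _; rewrite -!EFinD -EFinM !abse_EFin lee_fin ger0_norm ?powR_ge0//.
rewrite ger0_norm ?mulr_ge0 ?addr_ge0 ?powR_ge0//.
apply: le_trans (powR_add_le _ _ p0); rewrite ?logp_ge0 ?ln_ge0 ?ler1n//.
apply: ge0_ler_powR; rewrite ?nnegrE ?(ltW p0)//.
- exact/ln1_ge0/normc_ge0.
- by rewrite addr_ge0 ?logp_ge0// ln_ge0 ?ler1n.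
- exact/ln1_le_logp/normc_ge0.
Qed.

Lemma integrable_ln1B f g : measurable_fun setT f -> measurable_fun setT g ->
  logp_summable mu p f -> logp_summable mu p g ->
  mu.-integrable setT (fun x => (ln (1 + normc (f x - g x)) `^ p)%:E).
Proof.
move=> mf mg sf sg.
have : mu.-integrable setT (fun x => ((2 `^ p)%:E *
    ((ln (1 + normc (f x)) `^ p)%:E + (ln (1 + normc (g x)) `^ p)%:E))%E).
  by apply: integrableZl => //; apply: integrableD => //; exact: integrable_ln1.
apply: le_integrable => //.
  exact/measurable_EFinP/measurable_ln1p/measurable_normcB.
move=> x _; rewrite -!EFinD -EFinM !abse_EFin lee_fin ger0_norm ?powR_ge0//.
rewrite ger0_norm ?mulr_ge0 ?addr_ge0 ?powR_ge0//.
have ln0 h : 0 <= ln (1 + normc (h : R[i])) by exact/ln1_ge0/normc_ge0.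
apply: le_trans (powR_add_le _ _ p0) => //.
apply: ge0_ler_powR; rewrite ?nnegrE ?(ltW p0) ?addr_ge0//.
apply: le_trans (ln1_add _ _); rewrite ?normc_ge0//.
apply: ln1_mono; first exact: normc_ge0.
by have := @normcB_triangle R (f x) 0 (g x); rewrite subr0 sub0r normcN.
Qed.

End integrability.

Section ae.
Context d (T : measurableType d) (R : realType).
Context (mu : {measure set T -> \bar R}) (p : R).
Implicit Types f g : T -> R[i].

Lemma measurable_ge_normcB f g t : measurable_fun setT f ->
  measurable_fun setT g -> measurable [set x | t <= normc (f x - g x)].
Proof.
move=> mf mg; rewrite -[X in measurable X]setTI.
have := measurable_normcB mf mg => /(_ measurableT [set` `[t, +oo[]).
rewrite [X in _ `&` X](_ : _ = [set x | t <= normc (f x - g x)]).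
  by apply; exact: measurable_itv.
by apply/seteqP; split => x /=; rewrite in_itv/= andbT.
Qed.

Lemma measure_ae (A B : set T) : measurable A -> measurable B ->
  (\forall x \ae mu, A x = B x) -> mu A = mu B.
Proof.
move=> mA mB AB.
rewrite -[A]setIT -[B]setIT -!integral_indic// ?setIT//.
apply: ae_eq_integral => //.
- exact/measurable_EFinP/measurable_indic.
- exact/measurable_EFinP/measurable_indic.
by apply: filterS AB => x AB _; rewrite !indicE /in_mem/= /in_set AB.
Qed.

Lemma Rintegral_ae (u v : T -> R) : measurable_fun setT u ->
  measurable_fun setT v -> u = v %[ae mu] ->
  (\int[mu]_x u x)%R = (\int[mu]_x v x)%R.
Proof.
move=> mu_ mv uv; apply: (congr1 fine); apply: ae_eq_integral => //.
- exact/measurable_EFinP.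
- exact/measurable_EFinP.
by apply: filterS uv => x /= uv /uv ->.
Qed.

Lemma logp_summable_ae f f' : measurable_fun setT f -> measurable_fun setT f' ->
  f = f' %[ae mu] -> logp_summable mu p f -> logp_summable mu p f'.
Proof.
rewrite /logp_summable => mf mf' ff'.
rewrite (@ae_eq_integral _ _ _ mu _ (fun x => (logp (normc (f' x)) `^ p)%:E))//.
- exact/measurable_EFinP/measurable_logp/measurable_normc.
- exact/measurable_EFinP/measurable_logp/measurable_normc.
by apply: filterS ff' => x /= ff' /ff' ->.
Qed.

Lemma dmeas_ae f f' g g' : measurable_fun setT f -> measurable_fun setT f' ->
  measurable_fun setT g -> measurable_fun setT g' ->
  f = f' %[ae mu] -> g = g' %[ae mu] -> dmeas mu f g = dmeas mu f' g'.
Proof.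
move=> mf mf' mg mg' ff' gg'; rewrite /dmeas.
apply: (congr1 inf); apply: eq_imagel => t _.
rewrite (@measure_ae [set x | t <= normc (f x - g x)]
                     [set x | t <= normc (f' x - g' x)])//.
- exact: measurable_ge_normcB.
- exact: measurable_ge_normcB.
- by near=> x => /=; rewrite (near ff' x)// (near gg' x).
Unshelve. all: by end_near. Qed.

Lemma dp_ae f f' g g' : measurable_fun setT f -> measurable_fun setT f' ->
  measurable_fun setT g -> measurable_fun setT g' ->
  f = f' %[ae mu] -> g = g' %[ae mu] -> dp mu p f g = dp mu p f' g'.
Proof.
move=> mf mf' mg mg' ff' gg'; rewrite /dp (dmeas_ae mf mf' mg mg' ff' gg').
apply: (congr1 (fun z => dmeas mu f' g' + z)); apply: Rintegral_ae.
- apply: measurableT_comp => //.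
  by apply: measurable_funB; exact/measurable_logp/measurable_normc.
- apply: measurableT_comp => //.
  by apply: measurable_funB; exact/measurable_logp/measurable_normc.
- by near=> x => _ /=; rewrite (near ff' x)// (near gg' x).
Unshelve. all: by end_near. Qed.

Lemma rhop_ae f f' g g' : measurable_fun setT f -> measurable_fun setT f' ->
  measurable_fun setT g -> measurable_fun setT g' ->
  f = f' %[ae mu] -> g = g' %[ae mu] -> rhop mu p f g = rhop mu p f' g'.
Proof.
move=> mf mf' mg mg' ff' gg'.
suff e : lognorm mu p (f \- g) = lognorm mu p (f' \- g') by rewrite /rhop e.
rewrite /lognorm; apply: (congr1 (fun z => z `^ p^-1)); apply: Rintegral_ae.
- exact/measurable_ln1p/measurable_normcB.
- exact/measurable_ln1p/measurable_normcB.
- by near=> x => _ /=; rewrite (near ff' x)// (near gg' x).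
Unshelve. all: by end_near. Qed.

End ae.

Section metrics.
Context d (T : measurableType d) (R : realType).
Context (mu : {finite_measure set T -> \bar R}) (p : R) (p0 : 0 < p).
Implicit Types f g h : Lplus mu p.

Lemma measurable_Lplus f : measurable_fun setT f.
Proof. exact: measurable_funPT. Qed.

Lemma Lplus_summable f : logp_summable mu p f.
Proof. exact/asboolP/(valP f). Qed.

Lemma Lplus_eq f g : (\forall x \ae mu, normc (f x - g x) = 0) -> f = g.
Proof.
move=> fg; apply/val_inj.
have : f = g %[ae mu].
  by apply: filterS fg => x /eq0_normc/eqP + _; rewrite subr_eq0 => /eqP.
by move=> /ae_eqP/eqP; rewrite !reprK.
Qed.

Let meas := measurable_Lplus.
Let summ := Lplus_summable.
Let nB f g x := normc (f x - g x).

Let Iln f g := (\int[mu]_x (ln (1 + nB f g x) `^ p))%R.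

Let nB0 f g x : 0 <= nB f g x. Proof. exact: normc_ge0. Qed.

Let l0 f g x : 0 <= ln (1 + nB f g x). Proof. exact/ln1_ge0/nB0. Qed.

Let integrableI f g :
  mu.-integrable setT (fun x => (ln (1 + nB f g x) `^ p)%:E).
Proof. exact: integrable_ln1B. Qed.

Let I_ge0 f g : 0 <= Iln f g.
Proof. by apply: Rintegral_ge0 => x _; exact: powR_ge0. Qed.

Let rhopE f g : rhop mu p f g = if 1 < p then Iln f g `^ p^-1 else Iln f g.
Proof.
rewrite /rhop /lognorm; case: ifP => // _.
by rewrite -powRrM mulVf ?gt_eqF// powRr1//; exact: I_ge0.
Qed.

Lemma rhopxx f : rhop mu p f f = 0.
Proof.
rewrite rhopE; suff -> : Iln f f = 0.
  by case: ifP => // _; rewrite powR0// invr_eq0 gt_eqF.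
rewrite /Iln (@eq_Rintegral _ _ _ mu setT (fun=> 0)) ?Rintegral_cst ?mul0r// => x _.
by rewrite /nB subrr normc0 addr0 ln1 powR0// gt_eqF.
Qed.

Lemma rhop_sym f g : rhop mu p f g = rhop mu p g f.
Proof.
rewrite !rhopE; suff -> : Iln f g = Iln g f by [].
by apply: eq_Rintegral => x _; rewrite /nB normcBC.
Qed.

Lemma rhop_positivity f g : rhop mu p f g = 0 -> f = g.
Proof.
rewrite rhopE => I0; have {}I0 : Iln f g = 0.
  by move: I0; case: ifP => // _ /powR_eq0_eq0.
have : (\int[mu]_x `|(ln (1 + nB f g x) `^ p)%:E| = 0)%E.
  under eq_integral do rewrite gee0_abs ?lee_fin ?powR_ge0//.
  transitivity (Iln f g)%:E; last by rewrite I0.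
  by rewrite /Iln /Rintegral fineK//; exact: (integrable_fin_num _ (integrableI f g)).
move=> /ae_eq_integral_abs => /(_ measurableT) H.
apply: Lplus_eq.
have : ae_eq mu setT (fun x => (ln (1 + nB f g x) `^ p)%:E) (cst 0%E).
  by apply: H; exact: (measurable_int mu (integrableI f g)).
apply: filterS => x /= /(_ I)[] /powR_eq0_eq0 ln10.
apply/eqP; rewrite eq_le nB0 andbT leNgt; apply/negP => n0.
by have : 0 < ln (1 + nB f g x); [rewrite ln_gt0// ltrDl|rewrite ln10 ltxx].
Qed.

Let ln1_triangle g f h x :
  ln (1 + nB f h x) <= ln (1 + nB f g x) + ln (1 + nB g h x).
Proof.
apply: le_trans (ln1_add _ _) => //; apply: ln1_mono => //.
exact: normcB_triangle.
Qed.

Let LnormE (u : T -> R) : (forall x, 0 <= u x) ->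
  mu.-integrable setT (fun x => (u x `^ p)%:E) ->
  Lnorm mu p%:E (EFin \o u) = ((\int[mu]_x (u x `^ p))%R `^ p^-1)%:E.
Proof.
move=> u0 iu; rewrite unlock -poweR_EFin fineK; last first.
  exact: (integrable_fin_num _ iu).
congr (_ `^ _)%E; apply: eq_integral => x _ /=.
by rewrite ger0_norm.
Qed.

Lemma rhop_triangle g f h : rhop mu p f h <= rhop mu p f g + rhop mu p g h.
Proof.
rewrite (rhopE f h) (rhopE f g) (rhopE g h).
have [p1|p1] := ltP 1 p; last first.
  rewrite /Iln -RintegralD//; [|exact: integrableI|exact: integrableI].
  apply: le_Rintegral => //; first exact: integrableI.
    exact: (integrableD measurableT (integrableI f g) (integrableI g h)).
  move=> x _; apply: le_trans (powR_subadd (l0 f g x) (l0 g h x) _); last first.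
    by rewrite p0.
  apply: ge0_ler_powR; rewrite ?nnegrE ?addr_ge0 ?l0 ?(ltW p0)//.
pose u x := ln (1 + nB f g x); pose v x := ln (1 + nB g h x).
have u0 x : 0 <= u x by exact: l0.
have v0 x : 0 <= v x by exact: l0.
have mu_ : measurable_fun setT u by exact/measurable_ln1/measurable_normcB.
have mv : measurable_fun setT v by exact/measurable_ln1/measurable_normcB.
have iuv : mu.-integrable setT (fun x => ((u x + v x) `^ p)%:E).
  have : mu.-integrable setT (fun x => ((2 `^ p)%:E *
      ((u x `^ p)%:E + (v x `^ p)%:E))%E).
    by apply: integrableZl => //;
      exact: (integrableD measurableT (integrableI f g) (integrableI g h)).
  apply: le_integrable => //.
    apply/measurable_EFinP; apply: (measurableT_comp (measurable_powR p)).
    exact: measurable_funD.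
  move=> x _; rewrite -!EFinD -EFinM !abse_EFin lee_fin ger0_norm ?powR_ge0//.
  rewrite ger0_norm ?mulr_ge0 ?addr_ge0 ?powR_ge0//.
  exact: powR_add_le.
have uv0 x : 0 <= (u \+ v) x by rewrite addr_ge0.
have := minkowski_EFin mu mu_ mv (ltW p1).
rewrite (LnormE u0 (integrableI f g)) (LnormE v0 (integrableI g h)).
rewrite (LnormE uv0 iuv).
rewrite -EFinD lee_fin; apply: le_trans.
apply: ge0_ler_powR; rewrite ?nnegrE ?invr_ge0 ?(ltW p0)//.
  by apply: Rintegral_ge0 => x _; exact: powR_ge0.
apply: le_Rintegral => //; first exact: integrableI.
move=> x _.
apply: ge0_ler_powR; rewrite ?nnegrE ?addr_ge0 ?l0 ?(ltW p0)//.
exact: ln1_triangle.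
Qed.

Let A f g := [set t + fine (mu [set x | t <= nB f g x]) | t in [set t | 0 < t]].

Let J f g := (\int[mu]_x `|logp (normc (f x)) `^ p - logp (normc (g x)) `^ p|)%R.

Let integrableJ f g : mu.-integrable setT
  (fun x => (`|logp (normc (f x)) `^ p - logp (normc (g x)) `^ p|)%:E).
Proof. exact: integrable_logpB. Qed.

Let dpE f g : dp mu p f g = inf (A f g) + J f g. Proof. by []. Qed.

Let J_ge0 f g : 0 <= J f g. Proof. exact: Rintegral_ge0. Qed.

Let A_lb f g : lbound (A f g) 0.
Proof. by move=> _ [t /= t0 <-]; rewrite addr_ge0 ?(ltW t0)// fine_ge0. Qed.

Let A_neq0 f g : A f g !=set0.
Proof. by eexists; exists 1 => //=. Qed.

Let infA_ge0 f g : 0 <= inf (A f g).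
Proof. by apply: lb_le_inf => //; exact: A_lb. Qed.

Let infA_le f g t : 0 < t -> inf (A f g) <= t + fine (mu [set x | t <= nB f g x]).
Proof. by move=> t0; apply: ge_inf; [exists 0; exact: A_lb|exists t]. Qed.

Lemma dpxx f : dp mu p f f = 0.
Proof.
rewrite dpE [J _ _](_ : _ = 0) ?addr0; last first.
  by rewrite /J (@eq_Rintegral _ _ _ mu setT (fun=> 0)) ?Rintegral_cst ?mul0r// => x _; rewrite subrr normr0.
apply/eqP; rewrite eq_le infA_ge0 andbT; apply/ler_addgt0Pl => e e0.
rewrite addr0 (le_trans (infA_le f f e0))//.
rewrite [X in mu X](_ : _ = set0) ?measure0 ?addr0//.
by apply/seteqP; split => x //=; rewrite /nB subrr normc0 leNgt e0.
Qed.

Lemma dp_sym f g : dp mu p f g = dp mu p g f.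
Proof.
rewrite !dpE; apply: congr2.
- apply: (congr1 inf); apply: eq_imagel => t _.
  rewrite (_ : [set x | t <= nB f g x] = [set x | t <= nB g f x])//.
  by apply/funext => x; rewrite /= /nB normcBC.
- by apply: eq_Rintegral => x _; rewrite distrC.
Qed.

Let mset f g t : measurable [set x | t <= nB f g x].
Proof. exact: measurable_ge_normcB. Qed.

Lemma dp_triangle g f h : dp mu p f h <= dp mu p f g + dp mu p g h.
Proof.
rewrite !dpE addrACA lerD//; last first.
  rewrite /J -RintegralD//; [|exact: integrableJ|exact: integrableJ].
  apply: le_Rintegral => //; first exact: integrableJ.
    exact: (integrableD measurableT (integrableJ f g) (integrableJ g h)).
  by move=> x _; exact: ler_distD.
rewrite -lerBlDr; apply: lb_le_inf => // _ [t /= t0 <-].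
rewrite lerBlDr -lerBlDl; apply: lb_le_inf => // _ [s /= s0 <-].
rewrite lerBlDl (le_trans (infA_le f h (addr_gt0 t0 s0)))//.
rewrite addrACA lerD2l -fineD ?fin_num_measure//.
apply: fine_le; rewrite ?fin_numD ?fin_num_measure//.
apply: le_trans (measureU2 _ _ _) => //.
apply: le_measure; rewrite ?inE//; first exact: measurableU.
move=> x /= ts; have [tx|tx] := leP t (nB f g x); [by left|right].
rewrite leNgt; apply/negP => sx; move: ts; rewrite leNgt => /negP; apply.
by rewrite (le_lt_trans (normcB_triangle _ (g x) _))// ltrD.
Qed.

Lemma dp_positivity f g : dp mu p f g = 0 -> f = g.
Proof.
move=> /eqP; rewrite dpE paddr_eq0// => /andP[/eqP A0 _].
have mu0 e : 0 < e -> mu [set x | e <= nB f g x] = 0%E.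
  move=> e0; apply/eqP; rewrite eq_le measure_ge0 andbT.
  apply/lee_addgt0Pr => r r0; rewrite add0e.
  have er0 : 0 < Num.min e r by rewrite lt_min e0.
  have [|_ [t /= t0 <-]] := inf_adherent er0 (conj (A_neq0 f g) _ : has_inf _).
    by exists 0; exact: A_lb.
  rewrite A0 add0r lt_min => /andP[te tr].
  rewrite -[leLHS]fineK ?fin_num_measure// lee_fin.
  apply: le_trans (ltW tr); apply: (@le_trans _ _ (fine (mu [set x | t <= nB f g x]))).
    apply: fine_le; rewrite ?fin_num_measure//.
    apply: le_measure; rewrite ?inE// => x /=; apply: le_trans.
    by apply: le_trans (ltW te); rewrite lerDl fine_ge0.
  by rewrite lerDr ltW.
apply: Lplus_eq.
have : \forall x \ae mu, forall n, nB f g x < n.+1%:R^-1.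
  apply: ae_foralln => n; exists [set x | n.+1%:R^-1 <= nB f g x].
  by split => //; [exact: mu0|move=> x /= /negP; rewrite -leNgt].
apply: filterS => x xn; apply/eqP; rewrite eq_le nB0 andbT.
rewrite leNgt; apply/negP => x0.
have /ltW := xn (Num.truncn (nB f g x)^-1); rewrite leNgt => /negP; apply.
rewrite invf_plt ?posrE//.
exact: truncnS_gt.
Qed.

End metrics.

(* Two copies of [Lplus mu p], one for each metric. The argument [0 < p] is
   only used by the metric instances below. *)
Definition Lplus_d d (T : measurableType d) (R : realType)
  (mu : {finite_measure set T -> \bar R}) (p : R) (p0 : 0 < p) : Type :=
  Lplus mu p.

Definition Lplus_rho d (T : measurableType d) (R : realType)
  (mu : {finite_measure set T -> \bar R}) (p : R) (p0 : 0 < p) : Type :=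
  Lplus mu p.

Section instances.
Context d (T : measurableType d) (R : realType).
Context (mu : {finite_measure set T -> \bar R}) (p : R) (p0 : 0 < p).

HB.instance Definition _ := Choice.on (Lplus_d mu p0).
HB.instance Definition _ := @isMetric.Build R (Lplus_d mu p0)
  (fun f g : Lplus mu p => dp mu p f g) (@dpxx _ _ _ mu p)
  (@dp_positivity _ _ _ mu p) (@dp_sym _ _ _ mu p)
  (@dp_triangle _ _ _ mu p).

HB.instance Definition _ := Choice.on (Lplus_rho mu p0).
HB.instance Definition _ := @isMetric.Build R (Lplus_rho mu p0)
  (fun f g : Lplus mu p => rhop mu p f g) (rhopxx p0)
  (@rhop_positivity _ _ _ mu p p0) (rhop_sym p0)
  (rhop_triangle p0).

Lemma Lplus_d_mdistE (f g : Lplus_d mu p0) :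
  mdist f g = dp mu p (f : Lplus mu p) (g : Lplus mu p).
Proof. by []. Qed.

Lemma Lplus_rho_mdistE (f g : Lplus_rho mu p0) :
  mdist f g = rhop mu p (f : Lplus mu p) (g : Lplus mu p).
Proof. by []. Qed.

Definition topology_dp : set_system (Lplus mu p) := @open (Lplus_d mu p0).

Definition topology_rhop : set_system (Lplus mu p) := @open (Lplus_rho mu p0).

End instances.

Arguments topology_dp {d T R} mu {p} p0 _.
Arguments topology_rhop {d T R} mu {p} p0 _.

(* Main.v *)
(* Write I = \int ln(1 + |f - g|)^p and J = \int |log+|f|^p - log+|g|^p|, and fix
   f. Since log+ is Lipschitz for the distance ln(1 + |x - y|), and since
   (a + u)^p <= (1 + e) a^p + C_e u^p, we get J <= e \int log+|f|^p + C_e I, while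
   Markov's inequality controls the distance in measure by I. Conversely,
   ln(1 + |f - g|)^p is small where |f - g| is small, and elsewhere it is at most
   K (1 + 2 log+|f|^p) + K |log+|f|^p - log+|g|^p|; the integral of the first term
   over a set of small measure is small, and that of the second is at most K J. *)

Require Import Defs.
From HB Require Import structures.
From mathcomp Require Import all_boot all_order all_algebra.
From mathcomp Require Import all_classical all_reals all_analysis.
From mathcomp Require Import measurable_realfun complex.
From mathcomp Require Import lra.
Set Implicit Arguments.
Unset Strict Implicit.
Unset Printing Implicit Defensive.
Import Order.TTheory GRing.Theory Num.Theory.
Import numFieldNormedType.Exports.
Import Normc.
Local Open Scope classical_set_scope.
Local Open Scope ring_scope.

(** * Pointwise inequalities for powers and logarithms *)

Section real_inequalities.
Context {R : realType}.
Implicit Types a b u x y p e : R.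

Lemma powR_le p a b : 0 < p -> 0 <= a -> a <= b -> a `^ p <= b `^ p.
Proof.
move=> p0 a0 ab; apply: ge0_ler_powR; rewrite ?nnegrE ?(ltW p0)//.
exact: le_trans ab.
Qed.

Lemma powRVK p a : 0 < p -> 0 <= a -> (a `^ p^-1) `^ p = a.
Proof. by move=> p0 a0; rewrite -powRrM mulVf ?gt_eqF// powRr1. Qed.

Lemma powR_add_perturb p e : 0 < p -> 0 < e ->
  exists2 C, 0 < C & forall a u, 0 <= a -> 0 <= u ->
    (a + u) `^ p <= (1 + e) * a `^ p + C * u `^ p.
Proof.
move=> p0 e0; pose h := (1 + e) `^ p^-1 - 1.
have h0 : 0 < h.
  have E1 : 1 `^ p^-1 = 1 :> R by rewrite powR1.
  rewrite subr_gt0 -[X in X < _]E1.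
  by apply: gt0_ltr_powR; rewrite ?nnegrE ?invr_gt0 ?addr_ge0 ?ltrDl// ltW.
have hE : (1 + h) `^ p = 1 + e by rewrite addrC subrK powRVK// addr_ge0 ?ltW.
exists ((h^-1 + 1) `^ p) => [|a u a0 u0].
  by rewrite powR_gt0// addr_gt0 ?invr_gt0.
have [uha|hau] := leP u (h * a).
  apply: (@le_trans _ _ ((1 + e) * a `^ p)); last first.
    by rewrite lerDl mulr_ge0 ?powR_ge0.
  rewrite -hE -powRM//; last by rewrite addr_ge0// ltW.
  by apply: powR_le; rewrite ?addr_ge0// mulrDl mul1r lerD2l.
apply: (@le_trans _ _ ((h^-1 + 1) `^ p * u `^ p)); last first.
  by rewrite lerDr mulr_ge0 ?powR_ge0// addr_ge0 ?ltW.
rewrite -powRM// ?addr_ge0 ?invr_ge0 ?(ltW h0)//.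
apply: powR_le; rewrite ?addr_ge0// mulrDl mul1r lerD2r.
by rewrite ler_pdivlMl// ltW.
Qed.

(** The smaller of [a] and [b] is perturbed up to the larger one; since it is at most [a], the error
    can be charged to [a] alone. With [a] coming from the fixed [f], the bound then integrates
    uniformly in [g]. *)
Lemma powR_dist_perturb p e : 0 < p -> 0 < e ->
  exists2 C, 0 < C & forall a b u, 0 <= a -> 0 <= b -> `|a - b| <= u ->
    `|a `^ p - b `^ p| <= e * a `^ p + C * u `^ p.
Proof.
move=> p0 e0; have [C C0 H] := powR_add_perturb p0 e0.
have key a b u : 0 <= a -> a <= b -> b - a <= u ->
    b `^ p - a `^ p <= e * a `^ p + C * u `^ p.
  move=> a0 ab bau; have u0 : 0 <= u by rewrite (le_trans _ bau)// subr_ge0.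
  rewrite lerBlDr addrAC -[X in _ * _ + X]mul1r -mulrDl [e + 1]addrC.
  apply: le_trans (H a u a0 u0); apply: powR_le => //; first exact: le_trans ab.
  by rewrite -lerBlDl.
exists C => // a b u a0 b0 abu.
have [ab|/ltW ba] := leP a b.
  rewrite distrC ger0_norm ?subr_ge0 ?powR_le//; apply: key => //.
  by rewrite (le_trans _ abu)// distrC ler_norm.
rewrite ger0_norm ?subr_ge0 ?powR_le//.
apply: (@le_trans _ _ (e * b `^ p + C * u `^ p)).
  by apply: key => //; rewrite (le_trans _ abu)// ler_norm.
by rewrite lerD2r ler_wpM2l ?powR_le// ltW.
Qed.

Lemma le_logp x y : 0 <= x -> x <= y -> logp x <= logp y.
Proof.
move=> x0 xy; rewrite /logp ge_max !le_max lexx orbT andbT.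
have [->|xN0] := eqVneq x 0; first by rewrite ln0// lexx orbT.
have x_gt0 : 0 < x by rewrite lt_neqAle eq_sym xN0.
by rewrite ler_ln ?posrE ?xy// (lt_le_trans x_gt0).
Qed.

(** Take [y <= x]. If [y <= 1], then [x <= 1 + (x - y)]; if [y > 1], then [x <= (1 + (x - y)) * y],
    because the difference of the two sides is [(x - y) * (y - 1)]. *)
Lemma logp_dist x y : 0 <= x -> 0 <= y ->
  `|logp x - logp y| <= ln (1 + `|x - y|).
Proof.
wlog yx : x y / y <= x => [H x0 y0|x0 y0].
  have [|/ltW xy] := leP y x; first by move=> ?; exact: H.
  by rewrite distrC [`|x - y|]distrC; exact: H.
rewrite !ger0_norm ?subr_ge0 ?le_logp// lerBlDr.
have l0 : 0 <= ln (1 + (x - y)) by rewrite ln1_ge0// subr_ge0.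
rewrite [leLHS]/logp ge_max addr_ge0 ?logp_ge0// andbT.
have [xE|xN0] := eqVneq x 0; first by rewrite {1}xE ln0// addr_ge0 ?logp_ge0.
have x_gt0 : 0 < x by rewrite lt_neqAle eq_sym xN0.
have s0 : 0 < 1 + (x - y) by rewrite ltr_wpDr// subr_ge0.
have [y1|y1] := leP y 1.
  apply: (@le_trans _ _ (ln (1 + (x - y)))); last by rewrite lerDl logp_ge0.
  by rewrite ler_ln ?posrE//; lra.
have y_gt0 : 0 < y by rewrite (lt_trans _ y1).
apply: (@le_trans _ _ (ln (1 + (x - y)) + ln y)); last first.
  by rewrite lerD2l /logp le_max lexx.
by rewrite -lnM ?posrE// ler_ln ?posrE ?mulr_gt0//; nra.
Qed.

Lemma powR_ln1_le p x : 0 < p -> 0 <= x -> ln (1 + x) `^ p <= x `^ p.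
Proof.
move=> p0 x0; apply: powR_le; rewrite ?ln1_ge0//.
by rewrite le_ln1Dx// (lt_le_trans _ x0)// ltrN10.
Qed.

(** Bound [ln (1 + z)] by [2 ln 2 + logp x + logp y] and apply [powR_add_le] twice. Trading
    [logp y]^ p[for]logp x [^ p] plus their distance leaves a first term free of [y]. *)
Lemma powR_ln1_logp p : 0 < p -> exists2 K, 0 < K & forall x y z,
  0 <= x -> 0 <= y -> 0 <= z -> z <= x + y ->
  ln (1 + z) `^ p <= K * (1 + 2 * logp x `^ p)
                     + K * `|logp x `^ p - logp y `^ p|.
Proof.
move=> p0; pose c := (ln 2 + ln 2 : R).
have c0 : 0 <= c by rewrite addr_ge0// ln_ge0// ler1n.
pose K := 2 `^ p * (c `^ p + 2 `^ p).
have p2 : 0 < 2 `^ p by rewrite powR_gt0.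
exists K => [|x y z x0 y0 z0 zxy].
  by rewrite mulr_gt0// ltr_wpDl ?powR_ge0.
set a := logp x; set b := logp y.
have a0 : 0 <= a by exact: logp_ge0.
have b0 : 0 <= b by exact: logp_ge0.
have zc : ln (1 + z) <= c + (a + b).
  apply: (le_trans (ln1_mono z0 zxy)); apply: (le_trans (ln1_add x0 y0)).
  by rewrite addrACA lerD ?ln1_le_logp.
apply: (@le_trans _ _ (2 `^ p * (c `^ p + 2 `^ p * (a `^ p + b `^ p)))).
  apply: (le_trans (powR_le p0 (ln1_ge0 z0) zc)).
  apply: (le_trans (powR_add_le c0 (addr_ge0 a0 b0) p0)).
  by rewrite ler_wpM2l ?(ltW p2)// lerD2l powR_add_le.
have D : a `^ p + b `^ p <= 2 * a `^ p + `|a `^ p - b `^ p|.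
  have := ler_norm (b `^ p - a `^ p); rewrite distrC; lra.
rewrite -mulrDr /K -mulrA ler_wpM2l ?(ltW p2)//.
rewrite [leRHS]mulrDl lerD//.
  rewrite -[leLHS]mulr1 ler_wpM2l ?powR_ge0//.
  by rewrite -addrA lerDl addr_ge0// mulr_ge0 ?powR_ge0.
by rewrite ler_wpM2l ?(ltW p2)// (le_trans D)// -addrA lerDr.
Qed.

End real_inequalities.

(** * The integrals [I] and [J], and [I] against [rhop] *)

Section comparison.
Context d (T : measurableType d) (R : realType).
Context (mu : {finite_measure set T -> \bar R}) (p : R) (p0 : 0 < p).
Implicit Types f g : Lplus mu p.

Let a f x := logp (normc (f x)) `^ p.
Let u f g x := ln (1 + normc (f x - g x)) `^ p.
Let I f g := (\int[mu]_x u f g x)%R.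
Let J f g := (\int[mu]_x `|a f x - a g x|)%R.

Let int_a f : mu.-integrable setT (EFin \o a f).
Proof. by apply: integrable_logp; [exact: measurable_Lplus|exact: Lplus_summable]. Qed.

Let int_u f g : mu.-integrable setT (EFin \o u f g).
Proof.
by apply: integrable_ln1B => //; (exact: measurable_Lplus || exact: Lplus_summable).
Qed.

Let int_da f g : mu.-integrable setT (EFin \o (fun x => `|a f x - a g x|)).
Proof.
by apply: integrable_logpB; (exact: measurable_Lplus || exact: Lplus_summable).
Qed.

Let int_D (h k : T -> R) : mu.-integrable setT (EFin \o h) ->
  mu.-integrable setT (EFin \o k) ->
  mu.-integrable setT (EFin \o (fun x => h x + k x)).
Proof. by move=> ih ik; exact: (integrableD measurableT ih ik). Qed.

Let int_Z c (h : T -> R) : mu.-integrable setT (EFin \o h) ->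
  mu.-integrable setT (EFin \o (fun x => c * h x)).
Proof. by move=> ih; exact: (integrableZl measurableT c ih). Qed.

Let int_cst c : mu.-integrable setT (EFin \o (fun=> c)).
Proof. exact: finite_measure_integrable_cst. Qed.

Let int_restrict (h : T -> R) (A : set T) : measurable A ->
  mu.-integrable setT (EFin \o h) -> mu.-integrable setT (EFin \o (h \_ A)).
Proof.
move=> mA ih; rewrite -restrict_EFin; apply/(integrable_mkcond _ mA).1.
exact: integrableS ih.
Qed.

Let I_ge0 f g : 0 <= I f g.
Proof. by apply: Rintegral_ge0 => x _; exact: powR_ge0. Qed.

Let J_ge0 f g : 0 <= J f g. Proof. exact: Rintegral_ge0. Qed.

Let rhopE f g : rhop mu p f g = if 1 < p then I f g `^ p^-1 else I f g.
Proof. by rewrite /rhop /lognorm; case: ifP => // _; rewrite powRVK ?I_ge0. Qed.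

(** [rhop] is [I] or its [p]-th root, so smallness of one amounts to smallness of the other,
    uniformly in [f] and [g]; [small_rhop] is the converse direction. *)
Let rhop_small e : 0 < e ->
  exists2 r, 0 < r & forall f g, rhop mu p f g < r -> I f g < e.
Proof.
move=> e0; exists (if 1 < p then e `^ p^-1 else e) => [|f g].
  by case: ifP => // _; rewrite powR_gt0.
rewrite rhopE; case: ifP => // _; rewrite !ltNge; apply: contra => eI.
by rewrite powR_le ?invr_gt0// ltW.
Qed.

Let small_rhop e : 0 < e ->
  exists2 r, 0 < r & forall f g, I f g < r -> rhop mu p f g < e.
Proof.
move=> e0; exists (if 1 < p then e `^ p else e) => [|f g].
  by case: ifP => // _; rewrite powR_gt0.
rewrite rhopE; case: ifP => // _; rewrite !ltNge; apply: contra => eI.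
by rewrite -[leRHS](powRVK p0)// powR_le// ltW.
Qed.

(** * Distance in measure, and the two estimates around a fixed [f] *)

Let E f g t : set T := [set x | t <= normc (f x - g x)].

Let mE f g t : measurable (E f g t).
Proof. by apply: measurable_ge_normcB; exact: measurable_Lplus. Qed.

Let measure_values f g :=
  [set t + fine (mu [set x | t <= normc (f x - g x)]) | t in [set t | 0 < t]].

Let measure_values_lb f g : lbound (measure_values f g) 0.
Proof. by move=> _ [t /= t0 <-]; rewrite addr_ge0 ?(ltW t0)// fine_ge0. Qed.

Let dmeas_le f g t : 0 < t -> dmeas mu f g <= t + fine (mu (E f g t)).
Proof.
move=> t0; apply: ge_inf; last by exists t.
by exists 0; exact: measure_values_lb.
Qed.

Let dmeas_ge0 f g : 0 <= dmeas mu f g.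
Proof.
apply: lb_le_inf; last exact: measure_values_lb.
by eexists; exists 1 => //=.
Qed.

Let dmeas_lt f g r : dmeas mu f g < r ->
  exists2 t, 0 < t & t + fine (mu (E f g t)) < r.
Proof.
rewrite -subr_gt0 => r0.
have [|_ [t /= t0 <-]] := inf_adherent r0 (_ : has_inf (measure_values f g)).
  split; first by eexists; exists 1 => //=.
  by exists 0; exact: measure_values_lb.
by rewrite -/(dmeas mu f g) [ltRHS]addrC subrK => ?; exists t.
Qed.

Let markov_ln1 f g t : 0 < t -> ln (1 + t) `^ p * fine (mu (E f g t)) <= I f g.
Proof.
move=> t0; rewrite -(Rintegral_cst mu (mE f g t)) Rintegral_mkcond.
apply: le_Rintegral => //; first exact: int_restrict.
move=> x _; rewrite patchE; case: ifPn => [|_]; last exact: powR_ge0.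
rewrite inE => /= tx; apply: powR_le; rewrite ?ln1_ge0 ?(ltW t0)//.
by rewrite ln1_mono// ltW.
Qed.

Lemma rhop_dp f e : 0 < e ->
  exists2 r, 0 < r & forall g, rhop mu p f g < r -> dp mu p f g < e.
Proof.
(* Four contributions of size [t]: the level [t] and the measure of [E f g t] in [dmeas], then
   [s * M] and [C * I f g] in [J]. *)
move=> e0; pose t := e / 4; have t0 : 0 < t by rewrite divr_gt0.
set M := (\int[mu]_x a f x)%R.
have M0 : 0 <= M by apply: Rintegral_ge0 => x _; exact: powR_ge0.
have M1 : 0 < M + 1 by rewrite ltr_wpDl.
(* [M] may be zero, hence the division by [M + 1]. *)
pose s := t / (M + 1); have s0 : 0 < s by rewrite divr_gt0.
have [C C0 HC] := powR_dist_perturb p0 s0.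
pose l := ln (1 + t) `^ p.
have l0 : 0 < l by rewrite powR_gt0// ln_gt0// ltrDl.
(* The bound [t * l] gives [mu (E f g t) < t] by Markov; the bound [t / C] gives [C * I f g < t]. *)
have [r r0 Hr] : exists2 r, 0 < r & forall f g, rhop mu p f g < r ->
    I f g < Num.min (t * l) (t / C).
  by apply: rhop_small; rewrite lt_min mulr_gt0// divr_gt0.
exists r => // g /Hr; rewrite lt_min => /andP[I1 I2].
have m : fine (mu (E f g t)) < t.
  by rewrite -(ltr_pM2l l0) [l * t]mulrC (le_lt_trans (markov_ln1 f g t0)).
have JI : J f g <= s * M + C * I f g.
  rewrite -(RintegralZl _ measurableT (int_a f)).
  rewrite -(RintegralZl _ measurableT (int_u f g)).
  rewrite -RintegralD//; [|exact: int_Z|exact: int_Z].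
  apply: le_Rintegral => //; first by apply: int_D; exact: int_Z.
  move=> x _; apply: HC; rewrite ?logp_ge0//.
  apply: (le_trans (logp_dist (normc_ge0 _) (normc_ge0 _))).
  (* What remains is the reverse triangle inequality for the modulus. *)
  apply: ln1_mono => //; rewrite ler_norml; apply/andP; split.
    rewrite lerNl opprB lerBlDr normcBC.
    by have := normcB_triangle (g x) (f x) 0; rewrite !subr0.
  rewrite lerBlDr.
  by have := normcB_triangle (f x) (g x) 0; rewrite !subr0.
have sM : s * M <= t.
  by rewrite /s mulrAC ler_pdivrMr// ler_pM2l// lerDl.
have CI : C * I f g < t by rewrite mulrC -ltr_pdivlMr.
have := dmeas_le f g t0; move: sM CI JI m; rewrite /dp -/(J f g) /t; lra.
Qed.

Lemma dp_rhop f e : 0 < e ->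
  exists2 r, 0 < r & forall g, dp mu p f g < r -> rhop mu p f g < e.
Proof.
move=> /small_rhop[e1 e1_gt0 He].
have [K K0 HK] := powR_ln1_logp p0.
pose m := fine (mu setT); have m0 : 0 <= m by rewrite fine_ge0.
have m1 : 0 < m + 1 by rewrite ltr_wpDl.
pose w x := K * (1 + 2 * a f x).
have w0 x : 0 <= w x.
  by rewrite mulr_ge0 ?(ltW K0)// addr_ge0// mulr_ge0// powR_ge0.
have int_w : mu.-integrable setT (EFin \o w).
  by apply: int_Z; apply: int_D => //; exact: int_Z.
have e3 : 0 < e1 / 3 by rewrite divr_gt0.
(* Absolute continuity of the integral of [w], which depends on [f] only: [d0] is fixed before [g]
   is known. *)
have [d0 [d0_gt0 Hd0]] := integral_normr_continuous int_w e3.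
pose q := e1 / 3 / (m + 1); have q0 : 0 < q by rewrite divr_gt0.
pose r := Num.min d0 (Num.min (q `^ p^-1) (e1 / 3 / K)).
exists r => [|g]; first by rewrite !lt_min d0_gt0 powR_gt0//= divr_gt0.
rewrite /dp -/(J f g) => dr; apply: He.
(* The splitting level is not prescribed: it is a near-minimiser of the infimum, so that both [t]
   and the measure of [E f g t] are below [r]. *)
have [t t0] : exists2 t, 0 < t & t + fine (mu (E f g t)) < r.
  by apply: dmeas_lt; rewrite (le_lt_trans _ dr)// lerDl J_ge0.
rewrite !lt_min => /and3P[td tq _].
have Jr : J f g < e1 / 3 / K.
  move: dr; rewrite !lt_min => /and3P[_ _]; apply: le_lt_trans.
  by rewrite lerDr dmeas_ge0.
have wA : (\int[mu]_x (w \_ (E f g t)) x < e1 / 3)%R.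
  rewrite -Rintegral_mkcond.
  rewrite (@eq_Rintegral _ _ _ mu _ (fun x => `|w x|)) => [|x _]; last first.
    by rewrite ger0_norm.
  apply: Hd0 => //; rewrite -[ltLHS]fineK ?fin_num_measure// lte_fin.
  by rewrite (le_lt_trans _ td)// lerDr ltW.
have II : I f g <= q * m + (\int[mu]_x (w \_ (E f g t)) x)%R + K * J f g.
  rewrite -(Rintegral_cst mu measurableT).
  rewrite -(RintegralZl _ measurableT (int_da f g)).
  have int_r : mu.-integrable setT (EFin \o (w \_ (E f g t))).
    exact: int_restrict.
  have int_qr : mu.-integrable setT (EFin \o (fun x => q + (w \_ (E f g t)) x)).
    exact: int_D.
  have int_K := int_Z K (int_da f g).
  rewrite -RintegralD// -RintegralD//.
  apply: le_Rintegral => //; first exact: int_D.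
  move=> x _; rewrite patchE; case: ifPn => [_|].
    rewrite -addrA; apply: (@le_trans _ _ (w x + K * `|a f x - a g x|)); last first.
      by rewrite lerDr ltW.
    apply: HK; rewrite ?normc_ge0//.
    by have := normcB_triangle (f x) 0 (g x); rewrite subr0 sub0r normcN.
  rewrite notin_setE /E/= => /negP; rewrite -ltNge => xt.
  rewrite addr0; apply: (@le_trans _ _ q); last first.
    by rewrite lerDl mulr_ge0// ltW.
  apply: (le_trans (powR_ln1_le p0 (normc_ge0 _))).
  rewrite -[leRHS](powRVK p0) ?(ltW q0)//; apply: powR_le; rewrite ?normc_ge0//.
  by rewrite (le_trans (ltW xt))// (le_trans _ (ltW tq))// lerDl fine_ge0.
have qm : q * m <= e1 / 3.
  by rewrite /q mulrAC ler_pdivrMr// ler_pM2l// lerDl.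
have KJ : K * J f g < e1 / 3 by rewrite mulrC -ltr_pdivlMr.
by apply: (le_lt_trans II); move: qm KJ wA; lra.
Qed.

End comparison.

(** * From radii to open sets *)

Lemma metric_openP (R : realType) (M : metricType R) (U : set M) :
  open U <-> forall x, U x ->
    exists2 e : R, 0 < e & forall y, mdist x y < e -> U y.
Proof.
rewrite openE; split=> [oU x /oU /nbhs_ballP[e /= e0 eU]|H x /H[e e0 eU]].
  by exists e => // y xy; apply: eU; rewrite ballEmdist.
by apply/nbhs_ballP; exists e => //; rewrite ballEmdist.
Qed.

Theorem theorem2p3 (R : realType) (d : measure_display) (T : measurableType d)
    (mu : {finite_measure set T -> \bar R}) (p : R) (p0 : 0 < p) :
  measure_is_complete mu -> mu [set: T] != 0%E ->
  topology_dp mu p0 = topology_rhop mu p0.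
Proof.
move=> _ _; apply/funext => U; apply/propext.
rewrite /topology_dp /topology_rhop; split.
(* Openness is tested at one centre at a time, so a radius depending on [f] suffices; each inclusion
   of topologies needs a ball of one metric inside a given ball of the other. *)
- move=> /(@metric_openP _ (Lplus_d mu p0)) oU.
  apply/(@metric_openP _ (Lplus_rho mu p0)) => f /oU[e e0 eU].
  have [r r0 H] := rhop_dp p0 f e0.
  by exists r => // g; rewrite Lplus_rho_mdistE => /H; exact: eU.
- move=> /(@metric_openP _ (Lplus_rho mu p0)) oU.
  apply/(@metric_openP _ (Lplus_d mu p0)) => f /oU[e e0 eU].
  have [r r0 H] := dp_rhop p0 f e0.
  by exists r => // g; rewrite Lplus_d_mdistE => /H; exact: eU.
Qed.
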